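(* Let $\mathcal{K}$ be a compact second-countable Hausdorff space, let $\mathcal{C}$ be the set of continuous functions $\mathcal{K}\to\mathbb{R}$, and let $\mathcal{F}\subseteq\mathcal{C}$ be a generating system. Let $(G_1,G_2,\dots)$ be a sequence of $\mathcal{K}$-decorated graphs with $|V(G_n)|\to\infty$. Then the following are equivalent: (i) $(G_1,G_2,\dots)$ is convergent; (ii) for every $\mathcal{C}$-decorated graph $F$, the numerical sequence $t(F,G_n)$ is convergent; (iii) for every $\mathcal{F}$-decorated graph $F$, the numerical sequence $t(F,G_n)$ is convergent.
   Context: For a set $S$ and $n\in\mathbb{Z}_+$, an $S$-decorated graph on $n$ nodes is a symmetric map $G:[n]\times[n]\to S$ (i.e. $G(x,y)=G(y,x)$); write $G_{x,y}=G(x,y)$ and $V(G)=[n]$. The set of $\mathcal{K}$-decorated graphs on $k$ nodes is a compact space with the product topology. A subset $\mathcal{F}\subseteq\mathcal{C}$ is a generating system if the linear span of $\mathcal{F}$ is dense in $\mathcal{C}$ in the supremum norm. Sampling: for a $\mathcal{K}$-decorated graph $G$ and $k\le|V(G)|$, pick an ordered $k$-tuple $(v_1,\dots,v_k)$ of distinct nodes of $G$ uniformly at random and let $\mathbb{G}(G,k)$ be the random $k$-node decorated graph with entries $\mathbb{G}(G,k)_{i,j}=G_{v_i,v_j}$ for $1\le i<j\le k$. A sequence $(G_n)$ with $|V(G_n)|\to\infty$ is convergent if for every $k\in\mathbb{N}$ and every continuous function $f$ on the space of these sampled decorated graphs (i.e. of the entries $(i,j)$, $1\le i<j\le k$), the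 limit $\lim_{n\to\infty}E\bigl(f(\mathbb{G}(G_n,k))\bigr)$ exists. For an $\mathcal{F}'$-decorated graph $F$ on $[k]$ (where $\mathcal{F}'\subseteq\mathcal{C}$) and a $\mathcal{K}$-decorated graph $G$, the weight of a map $\varphi:[k]\to V(G)$ is $w(\varphi)=\prod_{1\le i<j\le k}F_{i,j}\bigl(G_{\varphi(i),\varphi(j)}\bigr)$, $\hom(F,G)=\sum_{\varphi:[k]\to V(G)}w(\varphi)$, and $t(F,G)=\hom(F,G)/|V(G)|^k$. *)

(* Defs.v *)
From HB Require Import structures.
From mathcomp Require Import all_boot all_order all_algebra.
From mathcomp Require Import all_classical all_reals all_analysis.
Set Implicit Arguments. Unset Strict Implicit. Unset Printing Implicit Defensive.
Import Order.TTheory GRing.Theory Num.Theory.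
Import numFieldNormedType.Exports.
Local Open Scope classical_set_scope.
Local Open Scope ring_scope.

Record dgraph (S : Type) := DGraph {
  dg_n : nat;
  dg_map : 'I_dg_n -> 'I_dg_n -> S;
  dg_sym : forall x y, dg_map x y = dg_map y x }.
Arguments dg_n {S} d.
Arguments dg_map {S} d _ _.
Arguments dg_sym {S} d _ _.

Definition upair (k : nat) := {p : 'I_k * 'I_k | (p.1 < p.2)%N}.

Definition sample_entries (S : Type) (G : dgraph S) (k : nat)
  (v : 'I_k -> 'I_(dg_n G)) : upair k -> S :=
  fun p => dg_map G (v (val p).1) (v (val p).2).
Arguments sample_entries {S} G {k} v _.

(** E(f(G(G,k))): average of f over the uniformly random ordered k-tuple of
    distinct nodes (= injective maps [k] -> V(G)).  Only meaningful for
    k <= |V(G)| (otherwise there are no such tuples and the value is 0). *)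
Definition sample_exp (R : realType) (K : topologicalType) (G : dgraph K)
  (k : nat) (f : {ptws upair k -> K} -> R) : R :=
  (#|[set v : {ffun 'I_k -> 'I_(dg_n G)} | injectiveb v]|%:R)^-1 *
  \sum_(v in [set v : {ffun 'I_k -> 'I_(dg_n G)} | injectiveb v])
     f (sample_entries G v).
Arguments sample_exp {R K} G {k} f.

Definition dg_convergent (R : realType) (K : topologicalType)
  (Gs : nat -> dgraph K) : Prop :=
  forall (k : nat) (f : {ptws upair k -> K} -> R), continuous f ->
    exists l : R, (fun n => sample_exp (Gs n) f) @ \oo --> l.

Definition hom (R : realType) (K : Type) (F : dgraph (K -> R)) (G : dgraph K) : R :=
  \sum_(phi : {ffun 'I_(dg_n F) -> 'I_(dg_n G)})
    \prod_(i : 'I_(dg_n F)) \prod_(j : 'I_(dg_n F) | (i < j)%N)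
       dg_map F i j (dg_map G (phi i) (phi j)).

Definition tdens (R : realType) (K : Type) (F : dgraph (K -> R)) (G : dgraph K) : R :=
  hom F G / ((dg_n G)%:R ^+ dg_n F).

Definition generating_system (R : realType) (K : topologicalType)
  (F : set (K -> R)) : Prop :=
  forall g : K -> R, continuous g -> forall eps : R, 0 < eps ->
    exists (m : nat) (c : 'I_m -> R) (h : 'I_m -> K -> R),
      (forall i, F (h i)) /\
      (forall x : K, `|g x - \sum_(i < m) c i * h i x| <= eps).

(* Main.v *)
Require Import Defs.
From HB Require Import structures.
From mathcomp Require Import all_boot all_order all_algebra.
From mathcomp Require Import all_classical all_reals all_analysis.
Import Order.TTheory GRing.Theory Num.Theory.
Import numFieldNormedType.Exports.
Local Open Scope classical_set_scope.
Local Open Scope ring_scope.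

(** Under a random map [phi] the weight of [F] is a continuous function of the
    entries of the sampled graph, and a random map of a fixed set into [n] nodes
    fails to be injective with probability [O(1/n)]; so [t(F, G_n)] and the
    sampling expectation of that product function have the same limits.  Hence
    (iii) says that the expectations converge for products of functions of [F].
    The functions with convergent expectations are closed under uniform limits
    of linear combinations, so they contain all products of continuous
    functions; and these span a dense set, because a partition of unity on [K]
    allows one to freeze the coordinates of a continuous function one by one. *)

(** * Product topology, compactness and partitions of unity *)

Lemma continuous_ptws (X K : topologicalType) (I : Type)
    (f : X -> {ptws I -> K}) :
  (forall i, continuous (fun x => f x i)) -> continuous f.
Proof.
move=> cf x; apply/cvg_sup => i U [V] [[W] oW <-] Wfx WU.
apply: (filterS WU); apply: (cf i x).
by apply: open_nbhs_nbhs; split.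
Qed.

Lemma compact_finite_cover (K : topologicalType) (U : K -> set K) :
  compact [set: K] -> (forall a, nbhs a (U a)) ->
  exists s : seq K, forall x, exists2 a, a \in s & U a x.
Proof.
move=> /compact_near_coveringP cK nU.
(* [FF] consists of the properties shared by all finite lists that contain some fixed list;
   near-covering compactness along it yields one list good for every point. *)
pose FF := [set A : set (seq K) |
  exists s0 : seq K, forall s, {subset s0 <= s} -> A s].
have FFF : Filter FF.
  split; first by exists [::].
  - move=> A B [s As] [t Bt]; exists (s ++ t) => u stu; split.
      by apply: As => x xs; apply: stu; rewrite mem_cat xs.
    by apply: Bt => x xs; apply: stu; rewrite mem_cat xs orbT.
  - by move=> A B AB [s As]; exists s => u /As /AB.
have [|s Hs] := cK _ FF (fun s x => exists2 a, a \in s & U a x) FFF.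
  move=> a _; exists (U a, [set s | a \in s]); last first.
    by case=> y s /= [Uy as_]; exists a.
  by split=> //; exists [:: a] => s; apply; rewrite mem_head.
by exists s => x; apply: (Hs s).
Qed.

(** Complete regularity gives at each [a] a bump equal to 1 at [a] and 0 off [U a]; finitely many of
    them have a positive sum everywhere, by which they are divided. *)
Lemma partition_of_unity (R : realType) (K : topologicalType)
    (U : K -> set K) :
  hausdorff_space K -> compact [set: K] -> (forall a, nbhs a (U a)) ->
  exists (m : nat) (a : 'I_m -> K) (phi : 'I_m -> K -> R),
    [/\ forall i, continuous (phi i), forall i x, 0 <= phi i x,
        forall x, \sum_i phi i x = 1 & forall i x, ~ U (a i) x -> phi i x = 0].
Proof.
move=> hK cK nU.
have crK : completely_regular_space K.
  apply: (@normal_completely_regular R); first exact: compact_normal.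
  exact: hausdorff_accessible.
have /choice[g Hg] a : exists g : K -> R,
  [/\ continuous g, forall x, 0 <= g x, g a = 1 & forall x, ~ U a x -> g x = 0].
  have : uniform_separator [set a] (~` (interior (U a))).
    apply: crK; first by apply: open_closedC; exact: open_interior.
    by apply; exact: nU.
  move=> /(@uniform_separatorP K R)[g [cg g01 ga gB]].
  (* The separator [g] is 0 at [a] and 1 off the interior of [U a]. *)
  exists (fun x => 1 - g x); split.
  - by move=> x; apply: cvgB; [exact: cvg_cst|exact: cg].
  - move=> x; rewrite subr_ge0.
    by have /g01 : range g (g x) by []; rewrite /= in_itv /= => /andP[].
  - by have -> : g a = 0; [apply: ga; exists a|rewrite subr0].
  - move=> x Ux; apply/eqP; rewrite subr_eq0; apply/eqP/esym; apply: gB.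
    by exists x => //; apply: contra_not Ux; exact: interior_subset.
have [|s Hs] := compact_finite_cover K (fun a => [set x | 0 < g a x]) cK.
  move=> a; have [cg _ ga _] := Hg a.
  apply: (cg a [set y | 0 < y]); apply: open_nbhs_nbhs.
  by split; [exact: open_gt|rewrite /= ga].
pose a i := tnth (in_tuple s) i; pose G x := \sum_(i < size s) g (a i) x.
have g0 i x : 0 <= g (a i) x by have [] := Hg (a i).
have G0 x : 0 < G x.
  have [b /(@tnthP _ _ (in_tuple s))[i ->] gb] := Hs x.
  by rewrite /G (bigD1 i)//= ltr_wpDr// sumr_ge0.
exists (size s), a, (fun i x => g (a i) x / G x); split.
- move=> i x; apply: cvgM; first by have [+ _ _ _] := Hg (a i); exact.
  apply: cvgV; first by rewrite gt_eqF.
  by apply: cvg_big => [|j _]; [exact: add_continuous|]; have [+ _ _ _] := Hg (a j); exact.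
- by move=> i x; apply: divr_ge0; [exact: g0|exact/ltW/G0].
- by move=> x; rewrite -mulr_suml divff ?gt_eqF//; exact: G0.
- by move=> i x Ux; have [_ _ _ ->//] := Hg (a i); rewrite mul0r.
Qed.

Definition update (K : Type) (I : eqType) (x : I -> K) (p : I) (a : K) : I -> K :=
  fun q => if q == p then a else x q.

Lemma update_continuous (X K : topologicalType) (I : eqType) (p : I)
    (x : X -> {ptws I -> K}) (b : X -> K) :
  continuous x -> continuous b ->
  continuous (fun z => update K I (x z) p (b z) : {ptws I -> K}).
Proof.
move=> cx cb; apply: continuous_ptws => q; rewrite /update; case: eqP => _ z.
  exact: cb.
apply: (@cvg_comp _ _ _ x (fun y : {ptws I -> K} => y q)) (cx z) _.
exact: (@proj_continuous I (fun=> K) q).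
Qed.

Lemma ptws_compact (K : topologicalType) (I : eqType) :
  compact [set: K] -> compact [set: {ptws I -> K}].
Proof.
move=> cK; have := @tychonoff I (fun=> K) (fun=> setT) (fun=> cK).
by congr (compact _); apply/seteqP; split.
Qed.

Lemma compact_fun_bounded (R : realType) (K : topologicalType) (h : K -> R) :
  compact [set: K] -> continuous h -> exists B, forall x, `|h x| <= B.
Proof.
move=> cK ch.
have : compact (h @` setT).
  by apply: continuous_compact => //; exact: continuous_subspaceT.
move=> /compact_bounded[M [_ HM]]; exists (M + 1) => x.
by apply: (HM (M + 1)); [rewrite ltrDl|exists x].
Qed.

(* The tube lemma makes the oscillation of [f] in the coordinate [p] uniformly
   small over all values of the other coordinates. *)
Lemma coordinate_approx (R : realType) (K : topologicalType) (I : eqType)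
    (f : {ptws I -> K} -> R) (p : I) (eps : R) :
  hausdorff_space K -> compact [set: K] -> continuous f -> 0 < eps ->
  exists (m : nat) (a : 'I_m -> K) (phi : 'I_m -> K -> R),
    (forall i, continuous (phi i)) /\
    (forall x, `|f x - \sum_i phi i (x p) * f (update K I x p (a i))| <= eps).
Proof.
move=> hK cK cf e0.
pose U a := [set b | forall x, `|f (update K I x p b) - f (update K I x p a)| <= eps].
have nU a : nbhs a (U a).
  (* The difference is continuous in [(x, b)] and 0 at [b = a]; compactness of the product makes the
     neighbourhood of [a] independent of [x]. *)
  have /compact_near_coveringP cY := ptws_compact K I cK.
  have cx (x : {ptws I -> K}) :
      f (update K I z.1 p z.2) - f (update K I z.1 p a) @[z --> (x, a)] --> (0 : R).
    have c1 : continuous (fun z : {ptws I -> K} * K => z.1) by move=> z; exact: cvg_fst.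
    have c2 : continuous (fun z : {ptws I -> K} * K => z.2) by move=> z; exact: cvg_snd.
    rewrite -(subrr (f (update K I x p a))); apply: cvgB.
      exact: (cvg_comp _ _ (update_continuous _ _ _ p _ _ c1 c2 (x, a)) (cf _)).
    have c3 : continuous (fun _ : {ptws I -> K} * K => a) by move=> z; exact: cvg_cst.
    exact: (cvg_comp _ _ (update_continuous _ _ _ p _ _ c1 c3 (x, a)) (cf _)).
  have cov x : [set: {ptws I -> K}] x -> \forall x' \near x & b \near a,
      `|f (update K I x' p b) - f (update K I x' p a)| <= eps.
    by move=> _; move/cvgr0Pnorm_le: (cx x) => /(_ _ e0).
  have H := cY K (nbhs a) (fun b x =>
    `|f (update K I x p b) - f (update K I x p a)| <= eps) (nbhs_filter a) cov.
  by apply: (@filterS _ _ (nbhs_filter a) _ _ _ H) => b Hb x; exact: (Hb x).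
have [m [a [phi [cphi phi0 phi1 phiU]]]] := partition_of_unity R K U hK cK nU.
exists m, a, phi; split=> // x.
(* The weights sum to 1, so the error is a weighted mean of differences; a nonzero weight forces
   [x p] into [U (a i)]. *)
rewrite -[f x]mul1r -(phi1 (x p)) mulr_suml -sumrB.
rewrite (le_trans (ler_norm_sum _ _ _))//.
rewrite -[leRHS]mul1r -(phi1 (x p)) mulr_suml; apply: ler_sum => i _.
rewrite -mulrBr normrM ger0_norm//.
have [Ux|Ux] := pselect (U (a i) (x p)); last by rewrite phiU// !mul0r.
apply: ler_wpM2l => //; have := Ux x.
suff -> : update K I x p (x p) = x by [].
by apply/funext => q; rewrite /update; case: eqP => // ->.
Qed.

(** * Density of products of one-variable functions *)

(** Closure under linear combinations and under uniform limits, merged into one condition. *)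
Definition span_closed (R : realType) (Y : Type) (L : set (Y -> R)) : Prop :=
  forall f : Y -> R,
  (forall eps, 0 < eps -> exists (m : nat) (c : 'I_m -> R) (g : 'I_m -> Y -> R),
     (forall i, L (g i)) /\ (forall x, `|f x - \sum_i c i * g i x| <= eps)) ->
  L f.

Lemma prod_bounded (R : realType) (K : topologicalType) (I : finType)
    (P : pred I) (h : I -> K -> R) :
  compact [set: K] -> (forall q, continuous (h q)) ->
  exists2 B, 0 <= B & forall x : I -> K, `|\prod_(q | P q) h q (x q)| <= B.
Proof.
move=> cK ch.
have /choice[b hb] q := compact_fun_bounded R K (h q) cK (ch q).
exists (\prod_(q | P q) `|b q|); first by apply: prodr_ge0.
move=> x; rewrite normr_prod; apply: ler_prod => q _.
by rewrite normr_ge0/= (le_trans (hb q (x q)))// ler_norm.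
Qed.

Lemma span_closed_prod (R : realType) (K : topologicalType) (I : finType)
    (F : set (K -> R)) (L : set ((I -> K) -> R)) :
  compact [set: K] -> F `<=` [set g : K -> R | continuous g] ->
  generating_system F -> span_closed R (I -> K) L ->
  (forall h : I -> K -> R, (forall q, F (h q)) -> L (fun x => \prod_q h q (x q))) ->
  forall h : I -> K -> R, (forall q, continuous (h q)) ->
    L (fun x => \prod_q h q (x q)).
Proof.
move=> cK Fc genF clL LF.
(* The list [s] covers the factors not yet known to lie in [F]; the induction replaces them one at a
   time. *)
suff H (s : seq I) (h : I -> K -> R) : (forall q, continuous (h q)) ->
    (forall q, q \notin s -> F (h q)) -> L (fun x => \prod_q h q (x q)).
  by move=> h ch; apply: (H (enum I)) => // q; rewrite mem_enum.
elim: s h => [|p s IHs] h ch hF; first by apply: LF => q; exact: hF.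
apply: clL => eps e0.
have [B B0 hB] := prod_bounded R K I (fun q => q != p) h cK ch.
(* The other factors multiply the error by at most [B]; adding 1 keeps the divisor positive when
   [B = 0]. *)
have [|m [c [k [kF kh]]]] := genF (h p) (ch p) (eps / (B + 1)).
  by rewrite divr_gt0// ltr_wpDl.
exists m, c, (fun i x => \prod_q (if q == p then k i else h q) (x q)); split.
  move=> i; apply: (IHs (fun q => if q == p then k i else h q)) => q.
    by case: eqP => // _; exact: Fc.
  move=> qs; case: (eqVneq q p) => // qp; apply: hF.
  by rewrite inE negb_or qp.
move=> x; rewrite (bigD1 p)//=.
under [X in _ - X]eq_bigr => i _.
  rewrite (bigD1 p)//= eqxx (eq_bigr (fun q => h q (x q))); last first.
    by move=> q /negbTE ->.
  rewrite mulrA; over.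
rewrite -mulr_suml -mulrBl normrM.
rewrite (le_trans (ler_pM _ _ (kh (x p)) (hB x)))//.
rewrite mulrAC ler_pdivrMr ?ltr_wpDl//.
by apply: ler_wpM2l; [exact: ltW|rewrite lerDl].
Qed.

(** This plays the part of the Stone-Weierstrass theorem on the finite power of [K]. *)
Lemma span_closed_continuous (R : realType) (K : topologicalType) (I : finType)
    (L : set ({ptws I -> K} -> R)) :
  K -> hausdorff_space K -> compact [set: K] -> span_closed R (I -> K) L ->
  (forall h : I -> K -> R, (forall q, continuous (h q)) ->
    L (fun x => \prod_q h q (x q))) ->
  forall f : {ptws I -> K} -> R, continuous f -> L f.
Proof.
move=> k0 hK cK clL LP.
(* Induction on the list [s] of coordinates on which [f] depends; the product
   of the [h q] absorbs the weights [phi i] of the partition of unity. *)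
suff H (s : seq I) (f : {ptws I -> K} -> R) (h : I -> K -> R) : continuous f ->
    (forall x y : I -> K, (forall q, q \in s -> x q = y q) -> f x = f y) ->
    (forall q, continuous (h q)) -> L (fun x => f x * \prod_q h q (x q)).
  move=> f cf; have := H (enum I) f (fun _ _ => 1) cf.
  have -> : (fun x : I -> K => f x * \prod_(q : I) 1) = f.
    by apply/funext => x; rewrite big1// mulr1.
  apply=> [x y xy|q x]; last exact: cvg_cst.
  by congr f; apply/funext => q; apply: xy; rewrite mem_enum.
elim: s f h => [|p s IHs] f h cf fs ch; apply: clL => eps e0.
  (* Here [f] depends on no coordinate, so it is constant, with its value read off at [k0]. *)
  exists 1%N, (fun=> f (fun=> k0)), (fun _ x => \prod_q h q (x q)).
  split=> [_|x]; first exact: LP.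
  by rewrite big_ord1 (fs x (fun=> k0))// subrr normr0 ltW.
have [B B0 hB] := prod_bounded R K I xpredT h cK ch.
have [|m [a [phi [cphi phif]]]] :=
    coordinate_approx R K I f p (eps / (B + 1)) hK cK cf.
  by rewrite divr_gt0// ltr_wpDl.
exists m, (fun=> 1), (fun i x => f (update K I x p (a i)) *
  \prod_q (if q == p then fun y => phi i y * h p y else h q) (x q)); split.
  move=> i; apply: (IHs (fun x => f (update K I x p (a i)))
    (fun q => if q == p then fun y => phi i y * h p y else h q)).
  - have c1 : continuous (fun x : {ptws I -> K} => x) by move=> x; exact: cvg_id.
    have c2 : continuous (fun _ : {ptws I -> K} => a i) by exact: cst_continuous.
    move=> x.
    exact: (cvg_comp _ _ (update_continuous _ _ _ p _ _ c1 c2 x) (cf _)).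
  - move=> x y xy; apply: fs => q; rewrite /update inE.
    by case: eqP => //= _ /xy.
  - move=> q; case: eqP => _ y; last exact: ch.
    apply: cvgM; first exact: cphi.
    exact: ch.
move=> x.
have -> : \sum_(i < m) 1 * (f (update K I x p (a i)) *
    \prod_q (if q == p then fun y => phi i y * h p y else h q) (x q)) =
    (\sum_(i < m) phi i (x p) * f (update K I x p (a i))) * \prod_q h q (x q).
  rewrite mulr_suml; apply: eq_bigr => i _.
  rewrite (bigD1 p)//= eqxx (eq_bigr (fun q => h q (x q))); last first.
    by move=> q /negbTE ->.
  by rewrite /= [in RHS](bigD1 p)//= mul1r !mulrA [f _ * phi _ _]mulrC.
rewrite -mulrBl normrM (le_trans (ler_pM _ _ (phif x) (hB x)))//.
rewrite mulrAC ler_pdivrMr ?ltr_wpDl//.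
by apply: ler_wpM2l; [exact: ltW|rewrite lerDl].
Qed.

(** * Averages over all maps and over injective maps *)

Lemma mean_le (R : realType) (T : finType) (A : pred T) (g : T -> R) (B : R) :
  0 <= B -> (forall v, `|g v| <= B) -> `|#|A|%:R^-1 * \sum_(v in A) g v| <= B.
Proof.
move=> B0 gB; rewrite normrM normfV normr_nat.
have [->|A0] := posnP #|A|; first by rewrite invr0 mul0r.
rewrite mulrC ler_pdivrMr ?ltr0n// mulr_natr -sumr_const.
by rewrite (le_trans (ler_norm_sum _ _ _))// ler_sum.
Qed.

(** Two errors of at most [B] times the density of the complement: the terms outside [A], and the
    rescaling of the mean over [A]. *)
Lemma mean_subset_dist (R : realType) (T : finType) (A : pred T) (g : T -> R)
    (B : R) : (0 < #|T|)%N -> 0 <= B -> (forall v, `|g v| <= B) ->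
  `|(\sum_v g v) / #|T|%:R - #|A|%:R^-1 * \sum_(v in A) g v|
    <= 2 * B * (1 - #|A|%:R / #|T|%:R).
Proof.
move=> T0 B0 gB.
have T0' : (#|T|%:R : R) != 0 by rewrite pnatr_eq0 -lt0n.
have E : (\sum_v g v) / #|T|%:R - #|A|%:R^-1 * \sum_(v in A) g v =
    (\sum_(v in predC A) g v) / #|T|%:R -
    (1 - #|A|%:R / #|T|%:R) * (#|A|%:R^-1 * \sum_(v in A) g v).
  rewrite (bigID (mem A))/=; set SA := \sum_(v in A) g v.
  rewrite [\sum_(_ in predC A) _](eq_bigl (fun v => v \notin A))//.
  have [A0|A0] := eqVneq (#|A|%:R : R) 0.
    rewrite A0 invr0 !mul0r mulr0 !subr0 [SA]big1 ?add0r// => v vA.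
    by move/eqP: A0; rewrite pnatr_eq0 => /eqP/card0_eq /(_ v); rewrite vA.
  set SC := bigop.body _ _ _.
  rewrite mulrBl mul1r mulrDl opprB addrA [SA / _ + _]addrC; congr (_ + _ - _).
  by rewrite mulrAC mulrA mulfV// mul1r mulrC.
rewrite {}E; apply: (le_trans (ler_normB _ _)).
rewrite -mulrA [2 * _]mulr_natl mulr2n; apply: lerD.
  rewrite normrM normfV normr_nat.
  have -> : 1 - #|A|%:R / #|T|%:R = #|predC A|%:R / #|T|%:R :> R.
    by rewrite -[X in X - _](divff T0') -mulrBl -{1}(cardC A) natrD addrAC subrr add0r.
  rewrite mulrA ler_wpM2r ?invr_ge0// mulr_natr -sumr_const.
  by rewrite (le_trans (ler_norm_sum _ _ _))// ler_sum.
have d0 : 0 <= 1 - #|A|%:R / #|T|%:R :> R.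
  by rewrite subr_ge0 ler_pdivrMr ?ltr0n// mul1r ler_nat max_card.
by rewrite normrM ger0_norm// mulrC ler_wpM2r// mean_le.
Qed.

(* Union bound on collisions, i.e. [1 - n ^_ k / n ^ k <= k ^ 2 / n], without
   division. *)
Lemma ffact_expn_dist (n k : nat) : (n * n ^ k <= n * n ^_ k + k ^ 2 * n ^ k)%N.
Proof.
elim: k => [|k IHk]; first by rewrite ffactn0 addn0.
have le1 : (n ^_ k <= n ^ k)%N.
  by elim: k {IHk} => // k IHk; rewrite ffactnSr expnSr leq_mul// leq_subr.
(* Truncated subtraction is harmless, as [n <= (n - k) + k] always holds. The loss [k] joins [k ^ 2]
   to stay below [k.+1 ^ 2]. *)
have le2 : (n * n ^_ k * n <= n * (n ^_ k * (n - k)) + k * n ^ k.+1)%N.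
  apply: (@leq_trans (n * n ^_ k * ((n - k) + k))).
    by rewrite leq_mul// addnC -leq_subLR.
  by rewrite mulnDr -mulnA leq_add2l mulnC expnS leq_mul// leq_mul.
rewrite ffactnSr {1}expnSr mulnA.
apply: (leq_trans (leq_mul IHk (leqnn n))).
rewrite mulnDl (leq_trans (leq_add le2 (leqnn _)))//.
rewrite -addnA leq_add2l -mulnA -expnSr -mulnDl leq_mul//.
by rewrite -!mulnn -mulSn leq_mul.
Qed.

(* [sample_exp] is stated with a classical set; this form uses a boolean
   predicate. *)
Lemma sample_expE (R : realType) (K : topologicalType) (G : dgraph K) (k : nat)
    (f : {ptws upair k -> K} -> R) :
  sample_exp G f =
  #|[pred v : {ffun 'I_k -> 'I_(dg_n G)} | injectiveb v]|%:R^-1 *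
  \sum_(v in [pred v : {ffun 'I_k -> 'I_(dg_n G)} | injectiveb v])
     f (sample_entries G v).
Proof.
have E : mem [set v : {ffun 'I_k -> 'I_(dg_n G)} | injectiveb v] =1
         mem [pred v : {ffun 'I_k -> 'I_(dg_n G)} | injectiveb v].
  by move=> v; apply/idP/idP => [/set_mem|H] //; exact/mem_set.
by rewrite /sample_exp (eq_card E) (eq_bigl _ _ E).
Qed.

(** * Homomorphism densities against sampling expectations *)

Lemma upair_prod (R : realType) (k : nat) (w : 'I_k -> 'I_k -> R) :
  \prod_(i < k) \prod_(j < k | (i < j)%N) w i j =
  \prod_(p : upair k) w (val p).1 (val p).2.
Proof.
rewrite pair_big_dep/=.
exact: (big_sub [pred p : 'I_k * 'I_k | (p.1 < p.2)%N] (fun p => w p.1 p.2)).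
Qed.

(** Averaging is linear and does not increase the uniform norm, so the error is the same for every
    [G]. *)
Lemma sample_exp_comb (R : realType) (K : topologicalType) (G : dgraph K)
    (k m : nat) (f : {ptws upair k -> K} -> R) (c : 'I_m -> R)
    (g : 'I_m -> {ptws upair k -> K} -> R) (eps : R) : 0 <= eps ->
  (forall x, `|f x - \sum_i c i * g i x| <= eps) ->
  `|sample_exp G f - \sum_i c i * sample_exp G (g i)| <= eps.
Proof.
move=> e0 fg; under [X in _ - X]eq_bigr => i _ do rewrite sample_expE mulrCA mulr_sumr.
rewrite -mulr_sumr exchange_big/= sample_expE -mulrBr -sumrB.
exact: (mean_le R _ _ (fun v => f (sample_entries G (v : {ffun _ -> _})) -
  \sum_i c i * g i (sample_entries G v))).
Qed.

Lemma approx_cvg (R : realType) (u : nat -> R) :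
  (forall eps, 0 < eps -> exists2 v : nat -> R,
     cvg (v @ \oo) & forall n, `|u n - v n| <= eps) -> cvg (u @ \oo).
Proof.
move=> uv; apply/cauchy_cvgP/cauchy_exP => e e0.
have [|v cv uve] := uv (e / 2); first by rewrite divr_gt0.
(* The Cauchy criterion asks only for some centre whose [e]-ball contains a tail of [u]. *)
exists (lim (v @ \oo)).
move/cvgrPdist_lt: cv => /(_ (e / 2)) []; first by rewrite divr_gt0.
move=> N _ HN; exists N => // n /HN /= vn.
rewrite /ball/= distrC -(subrKA (v n)) [e]splitr.
rewrite (le_lt_trans (ler_normD _ _))// ler_ltD// distrC//.
Qed.

(** Both are means of one function, over all maps and over injective maps. The bound also covers
    graphs with too few nodes, where [sample_exp] is 0. *)
Lemma tdens_sample_exp_dist (R : realType) (K : topologicalType)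
    (Fg : dgraph (K -> R)) (G : dgraph K) (B : R) :
  (0 < dg_n G)%N -> 0 <= B ->
  (forall x : upair (dg_n Fg) -> K,
     `|\prod_p dg_map Fg (val p).1 (val p).2 (x p)| <= B) ->
  `|tdens Fg G - sample_exp G (fun x : {ptws upair (dg_n Fg) -> K} =>
       \prod_p dg_map Fg (val p).1 (val p).2 (x p))| <=
  2 * B * ((dg_n Fg) ^ 2)%:R / (dg_n G)%:R.
Proof.
move=> n0 B0 hB; rewrite /tdens /Defs.hom; set k := dg_n Fg; set n := dg_n G.
under eq_bigr => phi _ do rewrite (upair_prod _ _
  (fun i j => dg_map Fg i j (dg_map G (phi i) (phi j)))).
have cT : #|{ffun 'I_k -> 'I_n}| = (n ^ k)%N by rewrite card_ffun !card_ord.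
rewrite -natrX -cT sample_expE.
set A := [pred _ | _].
have := mean_subset_dist R {ffun 'I_k -> 'I_n} A (fun v =>
  \prod_(p : upair k) dg_map Fg (val p).1 (val p).2 (sample_entries G v p)) B.
move=> /(_ _ B0)H; apply: (le_trans (H _ _)).
- by rewrite cT expn_gt0 n0.
- by move=> v; exact: hB.
rewrite -(mulrA _ (k ^ 2)%:R) ler_wpM2l ?mulr_ge0//.
have cA : #|A| = n ^_ k.
  transitivity (#|'I_n| ^_ #|'I_k|); last by rewrite !card_ord.
  rewrite -card_inj_ffuns; apply: eq_card => v.
  by rewrite !inE.
have n0' : 0 < n%:R :> R by rewrite ltr0n.
have N0 : 0 < (n ^ k)%:R :> R by rewrite ltr0n expn_gt0 n0.
(* Multiplying by [n * n ^ k] leaves the inequality [ffact_expn_dist] between natural numbers. *)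
rewrite cA cT -(ler_pM2r (mulr_gt0 n0' N0)) (mulrA (_ / _)) divfK ?gt_eqF//.
rewrite (mulrC n%:R) mulrA mulrBl mul1r divfK ?gt_eqF// mulrBl lerBlDl.
by rewrite -!natrM -natrD ler_nat mulnC [(_ ^_ _ * _)%N]mulnC ffact_expn_dist.
Qed.

Lemma tdens_sample_exp_cvg0 (R : realType) (K : topologicalType)
    (Gs : nat -> dgraph K) (Fg : dgraph (K -> R)) :
  compact [set: K] ->
  (forall M : nat, exists N0 : nat, forall n, (N0 <= n)%N -> (M <= dg_n (Gs n))%N) ->
  (forall i j, continuous (dg_map Fg i j)) ->
  tdens Fg (Gs n) - sample_exp (Gs n) (fun x : {ptws upair (dg_n Fg) -> K} =>
     \prod_p dg_map Fg (val p).1 (val p).2 (x p)) @[n --> \oo] --> (0 : R).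
Proof.
move=> cK Goo cF.
have [B B0 hB] := prod_bounded R K (upair (dg_n Fg)) xpredT
  (fun p => dg_map Fg (val p).1 (val p).2) cK (fun p => cF _ _).
set c := 2 * B * ((dg_n Fg) ^ 2)%:R.
have c0 : 0 <= c by rewrite !mulr_ge0.
apply/cvgr0Pnorm_le => e e0.
(* With more than [c / e] nodes the bound drops below [e]; the successor also ensures a node. *)
have [N HN] := Goo (Num.truncn (c / e)).+1.
exists N => // n /HN nM /=.
have n0 : (0 < dg_n (Gs n))%N by exact: leq_trans nM.
apply: (le_trans (tdens_sample_exp_dist R K Fg (Gs n) B n0 B0 hB)).
rewrite -/c ler_pdivrMr ?ltr0n// [leRHS]mulrC -ler_pdivrMr//; apply: ltW.
by rewrite (lt_le_trans (truncnS_gt _))// ler_nat.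
Qed.

Lemma cvg_sub0 (R : realType) (u v : nat -> R) :
  u n - v n @[n --> \oo] --> (0 : R) ->
  (exists l : R, u @ \oo --> l) <-> (exists l : R, v @ \oo --> l).
Proof.
move=> uv; split=> -[l cl]; exists l.
  rewrite -[l]subr0 (_ : v = fun n => u n - (u n - v n)); first exact: cvgB.
  by apply/funext => n; rewrite opprB addrC subrK.
rewrite -[l]add0r (_ : u = fun n => (u n - v n) + v n); first exact: cvgD.
by apply/funext => n; rewrite subrK.
Qed.

(** An empty combination is 0, which is not within 1/2 of the constant 1. *)
Lemma generating_system_nonempty (R : realType) (K : topologicalType)
    (F : set (K -> R)) : K -> generating_system F -> F !=set0.
Proof.
move=> x /(_ (fun=> 1) (fun _ => cvg_cst _) (1 / 2)) [|m [c [h [hF]]]].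
  by rewrite divr_gt0.
case: m c h hF => [|m] c h hF; last by exists (h ord0); exact: hF.
move=> /(_ x); rewrite big_ord0 subr0 normr1.
by rewrite ler_pdivlMr// mul1r lern1.
Qed.

(** The approximation error is uniform in [n], so convergence survives the limit. *)
Lemma sample_exp_span_closed (R : realType) (K : topologicalType)
    (Gs : nat -> dgraph K) (k : nat) :
  span_closed R (upair k -> K) [set f : {ptws upair k -> K} -> R |
    exists l : R, (fun n => sample_exp (Gs n) f) @ \oo --> l].
Proof.
move=> f Hf; apply/cvg_ex; apply: approx_cvg => e e0.
have [m [c [g [gL gf]]]] := Hf e e0.
exists (fun n => \sum_i c i * sample_exp (Gs n) (g i)).
  have /choice[l Hl] := gL.
  apply/cvg_ex; exists (\sum_i c i * l i).
  apply: cvg_big => [|i _]; first exact: add_continuous.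
  by apply: cvgM; [exact: cvg_cst|exact: Hl].
by move=> n; apply: sample_exp_comb => //; exact: ltW.
Qed.

Theorem theorem1 (R : realType) (K : topologicalType) (F : set (K -> R))
  (Gs : nat -> dgraph K) :
  hausdorff_space K -> compact [set: K] -> @second_countable K ->
  F `<=` [set g : K -> R | continuous g] -> generating_system F ->
  (forall M : nat, exists N0 : nat, forall n, (N0 <= n)%N -> (M <= dg_n (Gs n))%N) ->
  [<-> dg_convergent R Gs;
       forall Fg : dgraph (K -> R), (forall i j, continuous (dg_map Fg i j)) ->
         exists l : R, (fun n => tdens Fg (Gs n)) @ \oo --> l;
       forall Fg : dgraph (K -> R), (forall i j, F (dg_map Fg i j)) ->
         exists l : R, (fun n => tdens Fg (Gs n)) @ \oo --> l].
Proof.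
move=> hK cK _ Fc genF Goo.
(* Some graph in the sequence has a node, and its diagonal entry is a point of [K]. *)
have [k0] : inhabited K.
  have [N /(_ N (leqnn _)) HN] := Goo 1%N.
  exact: (inhabits (dg_map (Gs N) (Ordinal HN) (Ordinal HN))).
tfae.
- move=> conv Fg cF; apply/(cvg_sub0 _ _ _ (tdens_sample_exp_cvg0 R K Gs Fg cK Goo cF)).
  apply: conv; apply: continuous_big => [|p _ x]; first exact: mul_continuous.
  exact: (cvg_comp _ _ (@proj_continuous (upair _) (fun=> K) p x) (cF _ _ _)).
- by move=> conv Fg FF; apply: conv => i j; exact/Fc/FF.
- move=> conv k; have [h0 h0F] := generating_system_nonempty R K F k0 genF.
  pose L := [set f : {ptws upair k -> K} -> R |
    exists l : R, (fun n => sample_exp (Gs n) f) @ \oo --> l].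
  have clL : span_closed R (upair k -> K) L := sample_exp_span_closed R K Gs k.
  apply: (span_closed_continuous R K (upair k) L k0 hK cK clL).
  apply: (span_closed_prod R K (upair k) F L cK Fc genF clL).
  move=> h hF.
  (* Symmetric extension of [h], making any product of functions of [F] the weight of an
     [F]-decorated graph; [h0] fills the diagonal, which weights never read. *)
  pose w (i j : 'I_k) := if insub (i, j) is Some p then h p
    else if insub (j, i) is Some p then h p else h0.
  have w_sym i j : w i j = w j i.
    rewrite /w; case: insubP => [p /= ij pE|ij]; case: insubP => [q /= ji qE|ji] //=.
    by have := ltn_trans ij ji; rewrite ltnn.
  pose Fg := DGraph w_sym.
  have wF i j : F (dg_map Fg i j).
    rewrite /= /w; case: insubP => [p _ _|_]; first exact: hF.
    by case: insubP => [p _ _|_].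
  have -> : (fun x : upair k -> K => \prod_q h q (x q)) =
      (fun x => \prod_(p : upair k) dg_map Fg (val p).1 (val p).2 (x p)).
    apply/funext => x; apply: eq_bigr => -[[i j] ij] _ /=.
    by rewrite /w insubT.
  apply/(cvg_sub0 _ _ _ (tdens_sample_exp_cvg0 R K Gs Fg cK Goo
    (fun i j => Fc _ (wF i j)))).
  exact: conv.
Qed.
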